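(* Let $\mathcal{C}$ be a category equipped with a class $\mathcal{W}$ of weak equivalences and let $I$ be a small category. Assume that the colimit functor $\mathrm{colim}_I:\mathcal{C}^I\to\mathcal{C}$ exists. Then a functor $\mathcal{C}^I[\mathcal{W}^{-1}]\to\mathcal{C}[\mathcal{W}^{-1}]$ is a Grothendieck homotopy colimit if and only if it is a Quillen homotopy colimit.
   Context: A category $\mathcal{C}$ is equipped with an arbitrary class $\mathcal{W}$ of morphisms, called weak equivalences. $\gamma_{\mathcal{C}}:\mathcal{C}\to\mathcal{C}[\mathcal{W}^{-1}]$ is the localization obtained by formally inverting $\mathcal{W}$ (a possibly large category): $\gamma_{\mathcal{C}}$ sends $\mathcal{W}$ to isomorphisms and precomposition with $\gamma_{\mathcal{C}}$ is an equivalence from functors $\mathcal{C}[\mathcal{W}^{-1}]\to\mathcal{E}$ to functors $\mathcal{C}\to\mathcal{E}$ sending $\mathcal{W}$ to isomorphisms, for every category $\mathcal{E}$. A functor preserving weak equivalences induces a functor between localizations compatible with the functors $\gamma$. $\mathcal{C}^I$ is the category of functors $I\to\mathcal{C}$, equipped with the class, also denoted $\mathcal{W}$, of pointwise weak equivalences: natural transformations $\lambda$ with $\lambda_i\in\mathcal{W}$ for all $i\in I$. The constant diagram functor $c_I:\mathcal{C}\to\mathcal{C}^I$, $(c_I(x))(i)=x$, preserves weak equivalences and induces the localized constant diagram functor $c_I:\mathcal{C}[\mathcal{W}^{-1}]\to\mathcal{C}^I[\mathcal{W}^{-1}]$. A right Kan extension of $T:\mathcal{M}\to\mathcal{A}$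 along $K:\mathcal{M}\to\mathcal{X}$ is a functor $Ran_KT:\mathcal{X}\to\mathcal{A}$ with a natural transformation $\epsilon:(Ran_KT)K\to T$ such that for every $L:\mathcal{X}\to\mathcal{A}$ the map $\mathrm{Nat}(L,Ran_KT)\to\mathrm{Nat}(LK,T)$, $\lambda\mapsto\epsilon\circ(\lambda K)$, is bijective. It is absolute if for every functor $S:\mathcal{A}\to\mathcal{B}$ the pair $(S\,Ran_KT,\ S\epsilon)$ is a right Kan extension of $ST$ along $K$. The absolute left derived functor of $F:\mathcal{M}\to\mathcal{D}$ (both categories equipped with weak equivalences) is the absolute right Kan extension $\mathbb{L}F=Ran_{\gamma_{\mathcal{M}}}(\gamma_{\mathcal{D}}F)$. A Grothendieck homotopy colimit is a left adjoint $\mathcal{C}^I[\mathcal{W}^{-1}]\to\mathcal{C}[\mathcal{W}^{-1}]$ of the localized constant diagram functor. A Quillen homotopy colimit is an absolute left derived functor $\mathbb{L}\mathrm{colim}_I:\mathcal{C}^I[\mathcal{W}^{-1}]\to\mathcal{C}[\mathcal{W}^{-1}]$ of $\mathrm{colim}_I$. (A functor ''is'' such an object if it can be equipped with the corresponding structure: adjunction morphisms, respectively a unit $\epsilon$.) *)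

(* Defs.v *)
From Stdlib Require Import FunctionalExtensionality ProofIrrelevance.

Set Implicit Arguments.
Unset Strict Implicit.
Unset Printing Implicit Defensive.

Declare Scope cat_scope.
Delimit Scope cat_scope with cat.
Local Open Scope cat_scope.

(* Objects and hom-types share one universe, which is the universe of all
   categories below: it is closed under functor categories and under
   localization, so C[W^-1] is allowed to have hom-sets as large as the
   collection of objects of C. *)
Record Category := MkCategory {
  Ob :> Type;
  Hom : Ob -> Ob -> Type;
  idm : forall x, Hom x x;
  comp : forall x y z, Hom y z -> Hom x y -> Hom x z;
  comp_idl : forall x y (f : Hom x y), comp (idm y) f = f;
  comp_idr : forall x y (f : Hom x y), comp f (idm x) = f;
  comp_assoc : forall x y z t (h : Hom z t) (g : Hom y z) (f : Hom x y),
    comp h (comp g f) = comp (comp h g) f }.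

Arguments Hom {c} x y.
Arguments idm {c} x.
Arguments comp {c x y z} g f.
Notation "g \o f" := (comp g f) (at level 50, left associativity) : cat_scope.

Definition is_iso (C : Category) (x y : C) (f : Hom x y) : Prop :=
  exists g : Hom y x, g \o f = idm x /\ f \o g = idm y.

Definition isomorphic (C : Category) (x y : C) : Prop :=
  exists f : Hom x y, is_iso f.

Definition morphism_class (C : Category) := forall x y : C, Hom x y -> Prop.

Record Functor (C D : Category) := MkFunctor {
  fobj :> C -> D;
  fmap : forall x y : C, Hom x y -> Hom (fobj x) (fobj y);
  fmap_id : forall x, fmap (idm x) = idm (fobj x);
  fmap_comp : forall x y z (g : Hom y z) (f : Hom x y),
    fmap (g \o f) = fmap g \o fmap f }.

Arguments fmap {C D} f0 [x y] f.

Definition id_functor (C : Category) : Functor C C :=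
  @MkFunctor C C (fun x => x) (fun _ _ f => f)
    (fun _ => eq_refl) (fun _ _ _ _ _ => eq_refl).

Program Definition comp_functor (C D E : Category)
    (G : Functor D E) (F : Functor C D) : Functor C E :=
  @MkFunctor C E (fun x => G (F x)) (fun _ _ f => fmap G (fmap F f)) _ _.
Next Obligation. now intros; cbn; rewrite !fmap_id. Qed.
Next Obligation. now intros; cbn; rewrite !fmap_comp. Qed.

Notation "G \O F" := (comp_functor G F)
  (at level 50, left associativity) : cat_scope.

Record Nat (C D : Category) (F G : Functor C D) := MkNat {
  ncomp :> forall x : C, Hom (F x) (G x);
  naturality : forall (x y : C) (f : Hom x y),
    ncomp y \o fmap F f = fmap G f \o ncomp x }.

Lemma nat_ext (C D : Category) (F G : Functor C D) (a b : Nat F G) :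
  (forall x, a x = b x) -> a = b.
Proof.
destruct a as [a ha], b as [b hb]; simpl; intros e.
assert (e' : a = b) by (apply functional_extensionality_dep; exact e).
subst b; f_equal; apply proof_irrelevance.
Qed.

Program Definition nat_id (C D : Category) (F : Functor C D) : Nat F F :=
  @MkNat C D F F (fun x => idm (F x)) _.
Next Obligation. now intros; cbn; rewrite comp_idl, comp_idr. Qed.

Program Definition nat_vcomp (C D : Category) (F G H : Functor C D)
    (b : Nat G H) (a : Nat F G) : Nat F H :=
  @MkNat C D F H (fun x => b x \o a x) _.
Next Obligation.
now intros; cbn; rewrite <- comp_assoc, naturality, !comp_assoc, naturality.
Qed.

(* The category C^I of functors I -> C is [Fun I C]. *)
Program Definition Fun (C D : Category) : Category :=
  @MkCategory (Functor C D) (@Nat C D) (@nat_id C D) (@nat_vcomp C D) _ _ _.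
Next Obligation. now intros; apply nat_ext; intros; apply comp_idl. Qed.
Next Obligation. now intros; apply nat_ext; intros; apply comp_idr. Qed.
Next Obligation. now intros; apply nat_ext; intros; apply comp_assoc. Qed.

Program Definition whisker_right (C D E : Category) (G H : Functor D E)
    (a : Nat G H) (K : Functor C D) : Nat (G \O K) (H \O K) :=
  @MkNat C E (G \O K) (H \O K) (fun x => a (K x)) _.
Next Obligation. intros; exact (naturality a (fmap K f)). Qed.

Program Definition whisker_left (C D E : Category) (S : Functor D E)
    (F G : Functor C D) (a : Nat F G) : Nat (S \O F) (S \O G) :=
  @MkNat C E (S \O F) (S \O G) (fun x => fmap S (a x)) _.
Next Obligation. now intros; cbn; rewrite <- !fmap_comp, naturality. Qed.

(* [S eps : (S R) K -> S T] for [eps : R K -> T]; as functors, [(S \O R) \O K]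
   and [S \O (R \O K)] are not convertible, but their values are. *)
Program Definition whisker_left_ran (M X A B : Category) (S : Functor A B)
    (K : Functor M X) (T : Functor M A) (R : Functor X A)
    (eps : Nat (R \O K) T) : Nat ((S \O R) \O K) (S \O T) :=
  @MkNat M B ((S \O R) \O K) (S \O T) (fun x => fmap S (eps x)) _.
Next Obligation. intros; exact (naturality (whisker_left S eps) f). Qed.

Definition is_equivalence (C D : Category) (F : Functor C D) : Prop :=
  exists G : Functor D C,
    @isomorphic (Fun C C) (G \O F) (id_functor C) /\
    @isomorphic (Fun D D) (F \O G) (id_functor D).

Program Definition full_subcategory (C : Category) (P : C -> Prop) : Category :=
  @MkCategory {x : C | P x} (fun x y => Hom (proj1_sig x) (proj1_sig y))
    (fun x => idm (proj1_sig x)) (fun _ _ _ g f => g \o f) _ _ _.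
Next Obligation. now intros; apply comp_idl. Qed.
Next Obligation. now intros; apply comp_idr. Qed.
Next Obligation. now intros; apply comp_assoc. Qed.

Definition inverts (C : Category) (W : morphism_class C) (E : Category)
    (F : Functor C E) : Prop :=
  forall (x y : C) (f : Hom x y), W x y f -> is_iso (fmap F f).

Definition FunInv (C : Category) (W : morphism_class C) (E : Category) :=
  @full_subcategory (Fun C E) (fun F : Functor C E => inverts W F).

Lemma inverts_comp (C : Category) (W : morphism_class C) (D E : Category)
    (G : Functor D E) (F : Functor C D) : inverts W F -> inverts W (G \O F).
Proof.
intros hF x y f hf; destruct (hF x y f hf) as [g [e1 e2]].
exists (fmap G g); simpl.
now rewrite <- !fmap_comp, e1, e2, !fmap_id.
Qed.

Program Definition precomp (C : Category) (W : morphism_class C) (D : Category)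
    (gamma : Functor C D) (hgamma : inverts W gamma) (E : Category) :
    Functor (Fun D E) (FunInv W E) :=
  @MkFunctor (Fun D E) (FunInv W E)
    (fun F : Functor D E => exist _ (F \O gamma) (inverts_comp F hgamma))
    (fun (F G : Functor D E) (a : Nat F G) => whisker_right a gamma) _ _.
Next Obligation. now intros; apply nat_ext. Qed.
Next Obligation. now intros; apply nat_ext. Qed.

Definition is_localization (C : Category) (W : morphism_class C)
    (D : Category) (gamma : Functor C D) : Prop :=
  exists hgamma : inverts W gamma,
    forall E : Category, is_equivalence (precomp hgamma E).

(* Localizations being determined up to equivalence only, compatibility of an
   induced functor with the localization functors is up to natural
   isomorphism; this covers the case of a strict equality. *)
Definition is_induced_functor (C D HoC HoD : Category)
    (gammaC : Functor C HoC) (gammaD : Functor D HoD)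
    (F : Functor C D) (Fbar : Functor HoC HoD) : Prop :=
  @isomorphic (Fun C HoD) (Fbar \O gammaC) (gammaD \O F).

Definition pointwise (I C : Category) (W : morphism_class C) :
    morphism_class (Fun I C) :=
  fun (X Y : Functor I C) (a : Nat X Y) => forall i : I, W (X i) (Y i) (a i).

Program Definition const_functor (I C : Category) (x : C) : Functor I C :=
  @MkFunctor I C (fun _ => x) (fun _ _ _ => idm x) _ _.
Next Obligation. reflexivity. Qed.
Next Obligation. intros; exact (eq_sym (comp_idl (idm x))). Qed.

Program Definition const_nat (I C : Category) (x y : C) (f : Hom x y) :
    Nat (const_functor I x) (const_functor I y) :=
  @MkNat I C (const_functor I x) (const_functor I y) (fun _ => f) _.
Next Obligation. now simpl; intros; rewrite comp_idl, comp_idr. Qed.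

Program Definition const_diagram (I C : Category) : Functor C (Fun I C) :=
  @MkFunctor C (Fun I C) (@const_functor I C) (@const_nat I C) _ _.
Next Obligation. now intros; apply nat_ext. Qed.
Next Obligation. now intros; apply nat_ext. Qed.

Definition is_colimit (I C : Category) (X : Functor I C) (x : C)
    (s : Nat X (const_functor I x)) : Prop :=
  forall (y : C) (t : Nat X (const_functor I y)),
    exists! f : Hom x y, forall i : I, f \o s i = t i.

Definition is_colimit_functor (I C : Category)
    (colim : Functor (Fun I C) C) : Prop :=
  exists s : Nat (id_functor (Fun I C)) (const_diagram I C \O colim),
    forall X : Functor I C, is_colimit (s X).

Definition is_left_adjoint (C D : Category)
    (L : Functor C D) (R : Functor D C) : Prop :=
  exists (eta : Nat (id_functor C) (R \O L)) (eps : Nat (L \O R) (id_functor D)),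
    (forall x : C, eps (L x) \o fmap L (eta x) = idm (L x)) /\
    (forall y : D, fmap R (eps y) \o eta (R y) = idm (R y)).

Definition is_right_kan (M X A : Category) (K : Functor M X) (T : Functor M A)
    (R : Functor X A) (eps : Nat (R \O K) T) : Prop :=
  forall (L : Functor X A) (t : Nat (L \O K) T),
    exists! l : Nat L R, nat_vcomp eps (whisker_right l K) = t.

Definition is_absolute_right_kan (M X A : Category)
    (K : Functor M X) (T : Functor M A)
    (R : Functor X A) (eps : Nat (R \O K) T) : Prop :=
  is_right_kan eps /\
  forall (B : Category) (S : Functor A B),
    is_right_kan (whisker_left_ran S eps).

Definition is_absolute_left_derived (M D HoM HoD : Category)
    (gammaM : Functor M HoM) (gammaD : Functor D HoD)
    (F : Functor M D) (LF : Functor HoM HoD) : Prop :=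
  exists eps : Nat (LF \O gammaM) (gammaD \O F), is_absolute_right_kan eps.

Definition is_grothendieck_hocolim (HoC HoCI : Category)
    (cbar : Functor HoC HoCI) (L : Functor HoCI HoC) : Prop :=
  is_left_adjoint L cbar.

Definition is_quillen_hocolim (I C HoC HoCI : Category)
    (gammaC : Functor C HoC) (gammaCI : Functor (Fun I C) HoCI)
    (colim : Functor (Fun I C) C) (L : Functor HoCI HoC) : Prop :=
  is_absolute_left_derived gammaCI gammaC colim L.

(* Main.v *)
Require Import Defs.
From Stdlib Require Import ProofIrrelevance IndefiniteDescription.

(** Both notions of homotopy colimit are absolute right Kan extensions, of
    different functors along different functors, and the calculus of iterated
    Kan extensions identifies them. Write [g] for [gammaC], [G] for [gammaCI]
    and [c] for [const_diagram I C]. For a functor [L : HoCI -> HoC] the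
    following are equivalent:

    - [L] is the absolute right Kan extension of [g colim] along [G], that is,
      an absolute left derived functor of [colim];
    - [L] is the absolute right Kan extension of [g] along [G c];
    - [L] is the absolute right Kan extension of [g] along [cbar g];
    - [L] is the absolute right Kan extension of the identity along [cbar];
    - [L] is left adjoint to [cbar].

    The last equivalence is the classical description of a left adjoint, with
    the counit as Kan extension morphism
    ([left_adjoint_iff_absolute_ran]). Applied to [colim] and [c], it also
    shows that [g colim] is the absolute right Kan extension of [g] along [c];
    since extending along [c] and then along [G] amounts to extending along
    [G c] ([is_absolute_ran_paste]), the first two conditions agree. The
    second and the third differ by the isomorphism between [G c] and [cbar g].
    Finally, precomposition with the localization functor [g] is fully
    faithful, which says that the identity of [HoC] is the absolute right Kan
    extension of [g] along itself ([localization_codense]), and pasting gives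
    the equivalence of the third and the fourth. *)

Set Implicit Arguments.
Unset Strict Implicit.
Unset Printing Implicit Defensive.

Local Open Scope cat_scope.

(** * Right Kan extensions componentwise *)

Lemma nat_eq (C D : Category) (F G : Functor C D) (a b : Nat F G) (x : C) :
  a = b -> a x = b x.
Proof. now intros ->. Qed.

Lemma comp_functor_id_r (C D : Category) (F : Functor C D) :
  F \O id_functor C = F.
Proof.
destruct F as [o m hi hc]; unfold comp_functor; cbn.
f_equal; apply proof_irrelevance.
Qed.

(** The universal property with natural transformations replaced by families
    of morphisms. It depends on the functors only through their values on
    objects and morphisms, so it is convertible for functors such as
    [S' \O (S \O R)] and [(S' \O S) \O R], or [id_functor A \O R] and [R],
    which are themselves not convertible. *)
Definition right_kan_components (M X A : Category) (K : Functor M X)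
    (T : Functor M A) (R : Functor X A) (eps : Nat (R \O K) T) : Prop :=
  forall (G : Functor X A) (t : forall x, Hom (G (K x)) (T x)),
    (forall x y (f : Hom x y), t y \o fmap G (fmap K f) = fmap T f \o t x) ->
    exists l : forall y, Hom (G y) (R y),
      (forall x y (f : Hom x y), l y \o fmap G f = fmap R f \o l x) /\
      (forall x, eps x \o l (K x) = t x) /\
      forall l' : forall y, Hom (G y) (R y),
        (forall x y (f : Hom x y), l' y \o fmap G f = fmap R f \o l' x) ->
        (forall x, eps x \o l' (K x) = t x) -> forall y, l y = l' y.

Lemma right_kanP (M X A : Category) (K : Functor M X)
    (T : Functor M A) (R : Functor X A) (eps : Nat (R \O K) T) :
  is_right_kan eps <-> right_kan_components eps.
Proof.
split.
- intros h G t ht.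
  destruct (h G (@MkNat M A (G \O K) T t ht)) as [l [hl ul]].
  exists l; split; [exact (naturality l)|split].
  + intros x; exact (nat_eq x hl).
  + intros l' hl' el' y.
    refine (nat_eq y (ul (MkNat hl') _)).
    apply nat_ext; exact el'.
- intros h G t.
  destruct (h G t (naturality t)) as [l [hl [el ul]]].
  exists (MkNat hl); split.
  + apply nat_ext; exact el.
  + intros l' e; apply nat_ext; intros y; cbn.
    refine (ul l' (naturality l') _ y); intros x; exact (nat_eq x e).
Qed.

(** The Kan property of [eps] itself is the case of the identity functor. *)
Lemma absolute_right_kanP (M X A : Category) (K : Functor M X)
    (T : Functor M A) (R : Functor X A) (eps : Nat (R \O K) T) :
  is_absolute_right_kan eps <->
  forall (B : Category) (S : Functor A B),
    is_right_kan (whisker_left_ran S eps).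
Proof.
split; [now intros []|intros h; split; [|exact h]].
apply right_kanP.
exact (proj1 (right_kanP _) (h A (id_functor A))).
Qed.

Lemma absolute_right_kan_whisker (M X A B : Category) (K : Functor M X)
    (T : Functor M A) (R : Functor X A) (eps : Nat (R \O K) T)
    (S : Functor A B) :
  is_absolute_right_kan eps ->
  is_absolute_right_kan (whisker_left_ran S eps).
Proof.
intros h; apply absolute_right_kanP; intros E S'; apply right_kanP.
exact (proj1 (right_kanP _)
  (proj1 (absolute_right_kanP _) h E (S' \O S))).
Qed.

(** * Iterated Kan extensions *)

Definition is_absolute_ran (M X A : Category) (K : Functor M X)
    (T : Functor M A) (R : Functor X A) : Prop :=
  exists eps : Nat (R \O K) T, is_absolute_right_kan eps.

Definition reassoc (M X Y A : Category) (K : Functor M X) (K' : Functor X Y)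
    (G : Functor Y A) (T0 : Functor M A) (t : Nat (G \O (K' \O K)) T0) :
    Nat ((G \O K') \O K) T0 :=
  @MkNat M A ((G \O K') \O K) T0 t (naturality t).

Program Definition paste (M X Y A : Category) (K : Functor M X)
    (K' : Functor X Y) (T0 : Functor M A) (T : Functor X A) (R : Functor Y A)
    (q : Nat (T \O K) T0) (eps : Nat (R \O K') T) :
    Nat (R \O (K' \O K)) T0 :=
  @MkNat M A (R \O (K' \O K)) T0 (fun x => q x \o eps (K x)) _.
Next Obligation.
intros; cbn.
rewrite <- comp_assoc.
pose proof (naturality eps (fmap K f)) as e; cbn in e; rewrite e.
pose proof (naturality q f) as e'; cbn in e'.
now rewrite !comp_assoc, e'.
Qed.

(** When [T] is the Kan extension of [T0] along [K], transformations
    [G \O K' -> T] correspond to transformations [G \O K' \O K -> T0], and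
    under this bijection composing with [eps] becomes composing with
    [paste q eps]. *)
Lemma right_kan_paste (M X Y A : Category) (K : Functor M X)
    (K' : Functor X Y) (T0 : Functor M A) (T : Functor X A) (R : Functor Y A)
    (q : Nat (T \O K) T0) (eps : Nat (R \O K') T) :
  is_right_kan q -> (is_right_kan eps <-> is_right_kan (paste q eps)).
Proof.
intros hq; split.
- intros h G t.
  destruct (hq (G \O K') (reassoc t)) as [u [hu uu]].
  destruct (h G u) as [l [hl ul]].
  exists l; split.
  + apply nat_ext; intros x; rewrite <- (nat_eq x hu : _ = t x), <- hl; cbn.
    now rewrite comp_assoc.
  + intros l' e; apply ul; symmetry; apply uu.
    apply nat_ext; intros x; rewrite <- e; cbn.
    now rewrite comp_assoc.
- intros h G u.
  set (t := paste q u).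
  destruct (h G t) as [l [hl ul]].
  exists l; split.
  + destruct (hq (G \O K') (reassoc t)) as [u' [_ uu]].
    transitivity u'; [symmetry|]; apply uu; apply nat_ext; intros x.
    * rewrite <- hl; cbn; now rewrite comp_assoc.
    * reflexivity.
  + intros l' e; apply ul; apply nat_ext; intros x; subst t; rewrite <- e; cbn.
    now rewrite comp_assoc.
Qed.

Lemma absolute_right_kan_paste (M X Y A : Category) (K : Functor M X)
    (K' : Functor X Y) (T0 : Functor M A) (T : Functor X A) (R : Functor Y A)
    (q : Nat (T \O K) T0) (eps : Nat (R \O K') T) :
  is_absolute_right_kan q ->
  (is_absolute_right_kan eps <-> is_absolute_right_kan (paste q eps)).
Proof.
intros hq; rewrite !absolute_right_kanP.
assert (E : forall B (S : Functor A B), whisker_left_ran S (paste q eps) =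
    paste (whisker_left_ran S q) (whisker_left_ran S eps)).
{ intros B S; apply nat_ext; intros x; apply (fmap_comp S). }
split; intros h B S; specialize (h B S); rewrite E in *;
  now apply (right_kan_paste (whisker_left_ran S eps) (proj2 hq B S)).
Qed.

(** Every candidate morphism for [R] along [K' \O K] is pasted from one along
    [K'], by the universal property of [q]. *)
Lemma is_absolute_ran_paste (M X Y A : Category) (K : Functor M X)
    (K' : Functor X Y) (T0 : Functor M A) (T : Functor X A) (R : Functor Y A) :
  is_absolute_ran K T0 T ->
  (is_absolute_ran K' T R <-> is_absolute_ran (K' \O K) T0 R).
Proof.
intros [q hq]; split.
- intros [eps h]; exists (paste q eps); now apply absolute_right_kan_paste.
- intros [t h].
  destruct (proj1 hq (R \O K') (reassoc t)) as [eps [e _]].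
  exists eps; apply (absolute_right_kan_paste eps hq).
  replace (paste q eps) with t; [exact h|].
  apply nat_ext; intros x; exact (eq_sym (nat_eq x e)).
Qed.

(** * Kan extensions along isomorphic functors *)

Lemma right_kan_along_iso (M X A : Category) (K K' : Functor M X)
    (T : Functor M A) (R : Functor X A)
    (eps : Nat (R \O K) T) (a : Nat K K') (b : Nat K' K) :
  (forall x, a x \o b x = idm (K' x)) ->
  (forall x, b x \o a x = idm (K x)) ->
  is_right_kan eps -> is_right_kan (nat_vcomp eps (whisker_left R b)).
Proof.
intros ab ba h G t.
destruct (h G (nat_vcomp t (whisker_left G a))) as [l [hl ul]].
exists l; split.
- apply nat_ext; intros x; cbn.
  rewrite <- comp_assoc, <- naturality, comp_assoc.
  pose proof (nat_eq x hl) as e; cbn in e; rewrite e.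
  now rewrite <- comp_assoc, <- fmap_comp, ab, fmap_id, comp_idr.
- intros l' e; apply ul; subst t; apply nat_ext; intros x; cbn.
  now rewrite <- !comp_assoc, naturality, (comp_assoc (fmap R (b x))),
    <- fmap_comp, ba, fmap_id, comp_idl.
Qed.

Lemma is_absolute_ran_along_iso (M X A : Category) (K K' : Functor M X)
    (T : Functor M A) (R : Functor X A) :
  @isomorphic (Fun M X) K K' ->
  (is_absolute_ran K T R <-> is_absolute_ran K' T R).
Proof.
intros [a [b [ba ab]]].
assert (step : forall (K1 K2 : Functor M X) (u : Nat K1 K2) (v : Nat K2 K1),
  (forall x, u x \o v x = idm (K2 x)) -> (forall x, v x \o u x = idm (K1 x)) ->
  is_absolute_ran K1 T R -> is_absolute_ran K2 T R).
{ intros K1 K2 u v uv vu [eps h].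
  exists (nat_vcomp eps (whisker_left R v)).
  apply absolute_right_kanP; intros B S.
  replace (whisker_left_ran S (nat_vcomp eps (whisker_left R v)))
    with (nat_vcomp (whisker_left_ran S eps) (whisker_left (S \O R) v))
    by (apply nat_ext; intros x; symmetry; apply (fmap_comp S)).
  exact (right_kan_along_iso uv vu (proj2 h B S)). }
split; [apply (step K K' a b)|apply (step K' K b a)]; intros x;
  first [exact (nat_eq x ab)|exact (nat_eq x ba)].
Qed.

(** * Adjoints as absolute Kan extensions of the identity *)

(** For an adjunction, [t : G \O U -> S] corresponds to
    [t F] composed with [G eta], a transformation [G -> S \O F]. Conversely,
    the extension property of [U eps], which is where absoluteness enters,
    turns the identity of [U] into a unit satisfying one triangle identity; the
    other one compares two factorizations of [eps] through itself. *)
Lemma left_adjoint_iff_absolute_ran (X A : Category)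
    (F : Functor X A) (U : Functor A X) :
  is_left_adjoint F U <-> is_absolute_ran U (id_functor A) F.
Proof.
split.
- intros [eta [eps [tF tU]]]; exists eps.
  apply absolute_right_kanP; intros B S; apply right_kanP; intros G t ht.
  exists (fun x => t (F x) \o fmap G (eta x)); split; [|split].
  + intros x y f.
    pose proof (naturality eta f) as e; cbn in e.
    cbn; rewrite <- comp_assoc, <- fmap_comp, e, fmap_comp, comp_assoc, ht.
    now rewrite <- comp_assoc.
  + cbn in tU; intros y; cbn.
    pose proof (ht _ _ (eps y)) as e; cbn in e.
    now rewrite comp_assoc, <- e, <- comp_assoc, <- fmap_comp, tU, fmap_id,
      comp_idr.
  + cbn in tF; intros l hl el x.
    rewrite <- el; cbn.
    pose proof (hl _ _ (eta x)) as e; cbn in e.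
    now rewrite <- comp_assoc, e, comp_assoc, <- fmap_comp, tF, fmap_id,
      comp_idl.
- intros [eps h].
  destruct (proj1 (right_kanP _) (proj2 h X U) (id_functor X)
    (fun y => idm (U y))) as [eta [heta [tU _]]].
  { intros x y f; cbn; now rewrite comp_idl, comp_idr. }
  cbn in heta, tU.
  exists (@MkNat X X (id_functor X) (U \O F) eta heta), eps; split;
    [|exact tU].
  destruct (proj1 (right_kanP _) (proj1 h) F eps (naturality eps))
    as [l [_ [_ ul]]].
  intros x; cbn.
  (* [l] is the unique endomorphism of [F] with [eps \o l U = eps]. *)
  transitivity (l x);
    [symmetry; refine (ul (fun x => eps (F x) \o fmap F (eta x)) _ _ x)|
     refine (ul (fun x => idm (F x)) _ _ x)].
  + intros y z f; cbn.
    pose proof (naturality eps (fmap F f)) as e; cbn in e.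
    now rewrite <- comp_assoc, <- fmap_comp, heta, fmap_comp, comp_assoc, e,
      <- comp_assoc.
  + intros y; cbn.
    pose proof (naturality eps (eps y)) as e; cbn in e.
    now rewrite comp_assoc, <- e, <- comp_assoc, <- fmap_comp, tU, fmap_id,
      comp_idr.
  + intros y z f; now rewrite comp_idl, comp_idr.
  + intros y; apply comp_idr.
Qed.

(** * Colimits and localizations as Kan extensions *)

(** The counit at [y] is the fold map out of the colimit of the constant
    diagram, induced by the cocone of identities of [y]. *)
Lemma colimit_left_adjoint (I C : Category) (colim : Functor (Fun I C) C) :
  is_colimit_functor colim -> is_left_adjoint colim (const_diagram I C).
Proof.
intros [s hs].
assert (cancel : forall (X : Functor I C) (y : C) (f g : Hom (colim X) y),
  (forall i, f \o s X i = g \o s X i) -> f = g).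
{ intros X y f g e.
  destruct (hs X y (nat_vcomp (const_nat I g) (s X))) as [k [_ uk]].
  transitivity k; [symmetry|]; apply uk; [exact e|reflexivity]. }
(* The counit has to be a function of [y], while the colimit property only
   asserts existence: hence the choice operator. *)
pose (fold y := constructive_indefinite_description _
  (hs (const_functor I y) y (nat_id (const_functor I y)))).
pose (q y := proj1_sig (fold y)).
assert (hq : forall y i, q y \o s (const_functor I y) i = idm y).
{ intros y; exact (proj1 (proj2_sig (fold y))). }
assert (ns : forall (X Y : Functor I C) (f : Nat X Y) i,
  fmap colim (f : Hom (c := Fun I C) X Y) \o s X i = s Y i \o f i).
{ intros X Y f i; symmetry; exact (nat_eq i (naturality s f)). }
clearbody q; clear fold; cbn in hq, ns.
unshelve eexists s, (@MkNat C C (colim \O const_diagram I C) (id_functor C) q _).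
- intros x y f; apply cancel; intros i; cbn.
  rewrite <- comp_assoc.
  pose proof (ns _ _ (const_nat I f) i) as e; cbn in e; rewrite e.
  now rewrite comp_assoc, hq, <- comp_assoc, hq, comp_idl, comp_idr.
- split.
  + intros X; apply cancel; intros i; cbn.
    rewrite <- comp_assoc.
    pose proof (ns _ _ (s X) i) as e; cbn in e; rewrite e.
    now rewrite comp_assoc, hq.
  + intros y; apply nat_ext; intros i; exact (hq y i).
Qed.

(** Conjugating with [a] recovers [f] from [fmap G (fmap F f)], so [F] is
    faithful, and by the same argument with [b] so is [G]. Fullness follows:
    the preimage of [g] is found by conjugating [fmap G g], and checked after
    applying [G]. *)
Lemma equivalence_fully_faithful (C D : Category) (F : Functor C D) :
  is_equivalence F ->
  forall (x y : C) (g : Hom (F x) (F y)), exists! f : Hom x y, fmap F f = g.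
Proof.
intros [G [[[a na] [[a' na'] [ra ra']]] [[b nb] [[b' nb'] [rb rb']]]]].
pose proof (fun x => nat_eq x ra) as a'a.
pose proof (fun x => nat_eq x ra') as aa'.
pose proof (fun x => nat_eq x rb') as bb'.
cbn in *.
assert (conjugate : forall (x y : C) (f : Hom x y),
  a y \o fmap G (fmap F f) \o a' x = f).
{ intros x y f; now rewrite na, <- comp_assoc, aa', comp_idr. }
assert (faithfulG : forall (u v : D) (g g' : Hom u v),
  fmap G g = fmap G g' -> g = g').
{ intros u v g g' e.
  rewrite <- (comp_idr g), <- (comp_idr g'), <- bb', !comp_assoc, <- !nb.
  now rewrite e. }
intros x y g.
exists (a y \o fmap G g \o a' x); split.
- apply faithfulG.
  assert (k : forall v : Hom (G (F x)) (G (F y)), a' y \o (a y \o v) = v)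
    by (intros v; rewrite comp_assoc, a'a; apply comp_idl).
  rewrite <- (k (fmap G (fmap F _))), na, <- (k (fmap G g)).
  now rewrite <- (comp_assoc _ (a' x)), a'a, comp_idr.
- intros f <-; apply conjugate.
Qed.

(** Transformations [H -> S] between functors on [D] correspond to
    transformations [H \O gamma -> S \O gamma]: this is the full faithfulness
    of precomposition with [gamma], read as a Kan extension property. *)
Lemma localization_codense (C : Category) (W : morphism_class C)
    (D : Category) (gamma : Functor C D) :
  is_localization W gamma -> is_absolute_ran gamma gamma (id_functor D).
Proof.
intros [hg h].
exists (@MkNat C D (id_functor D \O gamma) gamma (fun x => idm (gamma x))
  (naturality (nat_id gamma))).
apply absolute_right_kanP; intros B S; apply right_kanP; intros G t ht.
pose (t' := @MkNat C B (G \O gamma) (S \O gamma) t ht).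
destruct (equivalence_fully_faithful (h B) (x := G) (y := S) t')
  as [l [hl ul]].
cbn in l, hl, ul.
exists l; split; [exact (naturality l)|split].
- intros x; cbn; rewrite fmap_id, comp_idl; exact (nat_eq x hl).
- intros l' hl' el' y.
  refine (nat_eq y (ul (@MkNat D B G S l' hl') _)).
  apply nat_ext; intros x; cbn.
  pose proof (el' x) as e; cbn in e; now rewrite fmap_id, comp_idl in e.
Qed.

Theorem proposition4p2
  (C : Category) (W : morphism_class C) (I : Category)
  (HoC : Category) (gammaC : Functor C HoC)
  (hgammaC : is_localization W gammaC)
  (HoCI : Category) (gammaCI : Functor (Fun I C) HoCI)
  (hgammaCI : is_localization (@pointwise I C W) gammaCI)
  (cbar : Functor HoC HoCI)
  (hcbar : is_induced_functor gammaC gammaCI (const_diagram I C) cbar)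
  (colim : Functor (Fun I C) C) (hcolim : is_colimit_functor colim)
  (L : Functor HoCI HoC) :
  is_grothendieck_hocolim cbar L <->
  is_quillen_hocolim gammaC gammaCI colim L.
Proof.
assert (hc : is_absolute_ran (const_diagram I C) gammaC (gammaC \O colim)).
{ destruct (proj1 (left_adjoint_iff_absolute_ran _ _)
    (colimit_left_adjoint hcolim)) as [q hq].
  rewrite <- (comp_functor_id_r gammaC) at 1.
  exists (whisker_left_ran gammaC q); now apply absolute_right_kan_whisker. }
transitivity (is_absolute_ran cbar (id_functor HoC) L);
  [apply left_adjoint_iff_absolute_ran|].
transitivity (is_absolute_ran (cbar \O gammaC) gammaC L);
  [exact (is_absolute_ran_paste cbar L (localization_codense hgammaC))|].
transitivity (is_absolute_ran (gammaCI \O const_diagram I C) gammaC L);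
  [exact (is_absolute_ran_along_iso gammaC L hcbar)|].
symmetry; exact (is_absolute_ran_paste gammaCI L hc).
Qed.
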